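(* Let $F:\mathbb{R}^n\to\mathbb{R}^n$ be a polynomial map and let $$K=\{x\in\mathbb{R}^n: g_i(x)\le 0,\ i\in[m],\ h_j(x)=0,\ j\in[\ell]\}$$ be nonempty, where $g_1,\dots,g_m$ are convex polynomial functions and $h_1,\dots,h_\ell$ are affine functions on $\mathbb{R}^n$. Assume that the Abadie constraint qualification holds at every point of $K$. If for every $\alpha\subset[m]$ the matrix $D\Phi_\alpha(x,\lambda_\alpha)$ has rank $n+|\alpha|+\ell$ for all $(x,\lambda_\alpha)\in\mathbb{R}^n\times\mathbb{R}^{|\alpha|}$, then $\operatorname{Sol}(K,F)$ has finitely many points.
   Context: Notation: $[m]=\{1,\dots,m\}$; subsets $\alpha\subset[m]$ may be empty or all of $[m]$. The solution set of the polynomial variational inequality is $\operatorname{Sol}(K,F)=\{x\in K:\langle F(x),y-x\rangle\ge 0\ \text{for all } y\in K\}$. For $\alpha\subset[m]$, write $g_\alpha=(g_i)_{i\in\alpha}$, $\lambda_\alpha=(\lambda_i)_{i\in\alpha}$, $h=(h_1,\dots,h_\ell)$, and define $\Phi_\alpha:\mathbb{R}^n\times\mathbb{R}^{|\alpha|}\times\mathbb{R}^\ell\to\mathbb{R}^{n+|\alpha|+\ell}$ by $$\Phi_\alpha(x,\lambda_\alpha,\mu)=\Big(F(x)+\sum_{i\in\alpha}\lambda_i\nabla g_i(x)+\sum_{j\in[\ell]}\mu_j\nabla h_j(x),\ g_\alpha(x),\ h(x)\Big)^T.$$ Its Jacobian does not depend on $\mu$ (since $h$ is affine) and is $$D\Phi_\alpha(x,\lambda_\alpha)=\begin{bmatrix}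 DF(x)+\sum_{i\in\alpha}\lambda_i\nabla^2 g_i(x) & \nabla g_\alpha(x) & \nabla h(x)\\ \nabla g_\alpha(x)^T&0&0\\ \nabla h(x)^T&0&0\end{bmatrix},$$ where $DF$ is the Jacobian of $F$, $\nabla^2 g_i$ is the Hessian of $g_i$, and $\nabla g_\alpha(x)$, $\nabla h(x)$ are the matrices whose columns are the gradients $\nabla g_i(x)$ ($i\in\alpha$) and $\nabla h_j(x)$ ($j\in[\ell]$). Abadie constraint qualification (ACQ) at $x\in K$: $L_K(x)=T_K(x)$, where $T_K(x)$ is the set of $v\in\mathbb{R}^n$ for which there are $y^k\in K$ and $t^k>0$ with $y^k\to x$, $t^k\to 0$, $(y^k-x)/t^k\to v$; and $L_K(x)=\{v:\langle\nabla g_i(x),v\rangle\le 0\ \forall i\in I(x),\ \langle\nabla h_j(x),v\rangle=0\ \forall j\in[\ell]\}$ with $I(x)=\{i\in[m]:g_i(x)=0\}$. ''Finitely many points'' includes the case of the empty set. *)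

(* Defs.v *)
From HB Require Import structures.
From mathcomp Require Import all_boot all_order all_algebra.
From mathcomp Require Import all_classical all_reals all_analysis.
(* Not imported: the notations of [mpoly] clash with those of MathComp-Analysis. *)
From mathcomp Require mpoly.

Set Implicit Arguments.
Unset Strict Implicit.
Unset Printing Implicit Defensive.

Import Order.TTheory GRing.Theory Num.Theory.
Import numFieldNormedType.Exports.

Local Open Scope classical_set_scope.
Local Open Scope ring_scope.

Notation "{ 'mpoly' T [ n ] }" := (mpoly.mpoly n T)
  (at level 0, T, n at level 2, format "{ 'mpoly'  T [ n ] }").

(* Points of R^n are row vectors, and polynomial functions on R^n are given by
   elements of {mpoly R[n]}. Gradients, Jacobians and Hessians are computed with
   formal partial derivatives; for polynomials over the reals these are the
   analytic ones. *)
Section Polynomials.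
Context {R : realType} {n : nat}.
Implicit Types (p : {mpoly R[n]}) (F : 'I_n -> {mpoly R[n]}) (x : 'rV[R]_n).

Definition polyfun p x : R := mpoly.meval (x 0) p.

Definition polymap F x : 'rV[R]_n := \row_i polyfun (F i) x.

Definition gradient p x : 'rV[R]_n := \row_i polyfun (mpoly.mderiv i p) x.

Definition jacobian_poly F x : 'M[R]_n :=
  \matrix_(i, j) polyfun (mpoly.mderiv j (F i)) x.

Definition hessian p x : 'M[R]_n :=
  \matrix_(i, j) polyfun (mpoly.mderiv i (mpoly.mderiv j p)) x.

Definition dot (u v : 'rV[R]_n) : R := \sum_i u 0 i * v 0 i.

Definition affine_poly p : Prop :=
  exists (a : 'rV[R]_n) (b : R), forall x, polyfun p x = dot a x + b.

Definition convex_poly p : Prop :=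
  convex_function (setT : set (convex_lmodType 'rV[R]_n)) (polyfun p).

End Polynomials.

Section VariationalInequality.
Context {R : realType} {n : nat}.

Definition Sol (K : set 'rV[R]_n) (F : 'rV[R]_n -> 'rV[R]_n) : set 'rV[R]_n :=
  [set x | K x /\ forall y, K y -> 0 <= dot (F x) (y - x)].

Definition tangent_cone (K : set 'rV[R]_n) (x : 'rV[R]_n) : set 'rV[R]_n :=
  [set v | exists (y : nat -> 'rV[R]_n) (t : nat -> R),
    [/\ (forall k, K (y k)) /\ (forall k, 0 < t k),
        y k @[k --> \oo] --> x,
        t k @[k --> \oo] --> (0 : R) &
        (t k)^-1 *: (y k - x) @[k --> \oo] --> v]].

End VariationalInequality.

Section Constraints.
Context {R : realType} {n m l : nat}.
Variables (F : 'I_n -> {mpoly R[n]}).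
Variables (g : 'I_m -> {mpoly R[n]}) (h : 'I_l -> {mpoly R[n]}).

Definition feasible_set : set 'rV[R]_n :=
  [set x | (forall i, polyfun (g i) x <= 0) /\ (forall j, polyfun (h j) x = 0)].

Definition linearized_cone (x : 'rV[R]_n) : set 'rV[R]_n :=
  [set v | (forall i, polyfun (g i) x = 0 -> dot (gradient (g i) x) v <= 0) /\
           (forall j, dot (gradient (h j) x) v = 0)].

Definition abadie_cq (x : 'rV[R]_n) : Prop :=
  linearized_cone x = tangent_cone feasible_set x.

(* The elements of alpha are listed as [enum_val k], k < #|alpha|; lambda_alpha
   is indexed by their ranks k. *)
Definition grad_ineq (alpha : {set 'I_m}) (x : 'rV[R]_n) : 'M[R]_(n, #|alpha|) :=
  \matrix_(i, k) gradient (g (enum_val k)) x 0 i.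

Definition grad_eq (x : 'rV[R]_n) : 'M[R]_(n, l) :=
  \matrix_(i, j) gradient (h j) x 0 i.

(* The Jacobian of
     Phi_alpha (x, lambda, mu) =
       (F x + \sum_(i in alpha) lambda_i grad g_i x + \sum_j mu_j grad h_j x,
        g_alpha x, h x),
   which does not depend on mu when the h_j are affine. The rows and columns of
   the last two blocks are grouped, whence the dimension n + (#|alpha| + l). *)
Definition DPhi (alpha : {set 'I_m}) (x : 'rV[R]_n) (lambda : 'rV[R]_#|alpha|) :
    'M[R]_(n + (#|alpha| + l)) :=
  block_mx
    (jacobian_poly F x
       + \sum_(k < #|alpha|) lambda 0 k *: hessian (g (enum_val k)) x)
    (row_mx (grad_ineq alpha x) (grad_eq x))
    (col_mx (grad_ineq alpha x)^T (grad_eq x)^T)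
    0.

End Constraints.

(* Main.v *)
Require Import Defs.
From mathcomp Require Import all_boot all_order all_algebra.
From mathcomp Require Import all_classical all_reals all_analysis.
From mathcomp Require Import ring.
Import -(notations) mpoly.

(** The Abadie condition turns a solution x into a zero of a square polynomial
    system. Let alpha be the set of inequalities active at x, and let v be
    orthogonal to the gradients at x of the g_i, i in alpha, and of all the h_j.
    Both v and - v lie in the linearized cone, hence in the tangent cone, along
    which F x has nonnegative inner products; so F x is orthogonal to v. By
    linear duality F x is a linear combination of those gradients, that is,
    x is the first component of a zero (x, lambda, mu) of Phi_alpha
    ([Sol_kkt]). Since the zeros of Phi_alpha are counted over all real
    multipliers, duality of subspaces takes the place of Farkas' lemma here. As
    there are finitely many alpha, it remains to see that each Phi_alpha has
    finitely many zeros.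

    The rank condition says that all zeros of Phi_alpha are nondegenerate
    ([jacobian_kkt_map]). A system P_1, ..., P_n of polynomials of degree less
    than d in n variables over a field has at most d ^ n nondegenerate zeros
    ([bezout_nondegenerate]). To see this, deform it into P_i = t x_i ^ d, with
    a parameter t.
    - Every nondegenerate zero a lifts by Newton iteration to a point z of
      R[t]^n with z = a at t = 0 that solves the deformed system modulo any
      given power of t ([hensel_lift]).
    - The deformed system allows one to replace t x_i ^ d by P_i, which has
      lower degree. Hence every polynomial, multiplied by a power t ^ s, is a
      combination over R[t] of the d ^ n monomials with all exponents below d,
      modulo the deformed system ([deformed_reduction]).
    Take M nondegenerate zeros, polynomials f_p that separate them, and lifts
    z_q. By the reduction, the M x M matrix with entries t ^ s f_p(z_q) is
    congruent modulo t ^ (s + 1) to a product of an M x d ^ n and a d ^ n x M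
    matrix. Divided by t ^ s, this product is diagonal and invertible at t = 0,
    so it has rank M, whence M <= d ^ n. *)

Set Implicit Arguments.
Unset Strict Implicit.
Unset Printing Implicit Defensive.

Import Order.TTheory GRing.Theory Num.Theory.
Import numFieldNormedType.Exports.

Local Open Scope classical_set_scope.
Local Open Scope ring_scope.

Local Notation monom := mpolyX.
Local Notation var i := (mpolyX _ (mnm1 i)).
Local Notation ev z q := (mmap (polyC : _ -> {poly _}) z q).

(** * Induction and Taylor expansion for multivariate polynomials *)

Lemma mpoly_ring_ind (R : comNzRingType) n (P : {mpoly R[n]} -> Prop) :
  (forall c, P (mpolyC n c)) -> (forall i, P (var i)) ->
  (forall p q, P p -> P q -> P (p + q)) ->
  (forall p q, P p -> P q -> P (p * q)) ->
  forall p, P p.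
Proof.
move=> PC PX PD PM; elim/mpolyind=> [|c m p _ _ Pp]; first exact: (PC 0).
apply: PD => //; rewrite -mul_mpolyC; apply: (PM) => //.
rewrite mpolyXE_id; apply: (big_ind P) => // [|i _]; first exact: (PC 1).
by elim: (m i) => [|k IH]; [exact: (PC 1) | rewrite exprS; apply: PM].
Qed.

Lemma mderiv_var (R : comNzRingType) n (i j : 'I_n) :
  mderiv i (var j : {mpoly R[n]}) = (j == i)%:R.
Proof.
rewrite mderivX mnm1E; case: eqVneq => [->|_]; last by rewrite scale0r.
by rewrite scale1r -{1}[mnm1 i]add0m addmK mpolyX0.
Qed.

(** First-order Taylor expansion with a remainder over an arbitrary commutative
    ring S. It serves with S = R[t], both for Newton steps (e a power of t) and
    for restrictions to a line (e = t). *)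
Lemma mmap_taylor (R S : comNzRingType) n (f : {rmorphism R -> S})
    (z w : 'I_n -> S) (e : S) (q : {mpoly R[n]}) :
  exists c, mmap f (fun i => z i + e * w i) q =
    mmap f z q + e * (\sum_i mmap f z (mderiv i q) * w i) + e ^+ 2 * c.
Proof.
elim/mpoly_ring_ind: q => [a|i|p q [c1 E1] [c2 E2]|p q [c1 E1] [c2 E2]].
- exists 0; rewrite !mmapC big1 ?mulr0 ?addr0// => i _.
  by rewrite mderivC mmap0 mul0r.
- exists 0; rewrite !mmapX !mmap1U mulr0 addr0.
  rewrite (bigD1 i) //= big1 ?addr0 => [|j ji].
    by rewrite mderiv_var eqxx rmorph1 mul1r.
  by rewrite mderiv_var eq_sym (negbTE ji) rmorph0 mul0r.
- exists (c1 + c2); rewrite !mmapD E1 E2.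
  under [in RHS]eq_bigr do rewrite mderivD mmapD mulrDl.
  by rewrite big_split /=; ring.
- under eq_bigr do rewrite mderivM mmapD !rmorphM /= mulrDl
    [_ * mmap f z q * _]mulrAC -[mmap f z p * _ * _]mulrA.
  rewrite big_split /= -mulr_suml -mulr_sumr rmorphM /= E1 E2 rmorphM /=.
  set u := mmap f z p; set v := mmap f z q.
  set U := \sum_i _; set V := \sum_i _.
  exists (U * V + u * c2 + c1 * v + e * (U * c2 + c1 * V) + e ^+ 2 * (c1 * c2)).
  by ring.
Qed.

(** * Counting nondegenerate zeros by deformation *)

Section Finiteness.
Variables (R : fieldType) (n d : nat) (P : 'I_n -> {mpoly R[n]}).

Lemma horner_ev (t : R) (z : 'I_n -> {poly R}) q :
  (ev z q).[t] = meval (fun i => (z i).[t]) q.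
Proof.
elim/mpoly_ring_ind: q => [c|i|p q Ep Eq|p q Ep Eq].
- by rewrite mmapC mevalC hornerC.
- by rewrite mmapX mmap1U mevalXU.
- by rewrite mmapD mevalD hornerD Ep Eq.
- by rewrite rmorphM /= mevalM hornerM Ep Eq.
Qed.

Lemma dvdX_horner0 (p : {poly R}) : ('X %| p) = (p.[0] == 0).
Proof. by rewrite -[X in X %| _]subr0 -polyC0 dvdp_XsubCl. Qed.

(** Newton iteration, started at the constant point a: the Jacobian of the
    deformed system at t = 0 is that of P at a, so it can be inverted to choose
    the coefficient of t ^ (k + 1) that cancels the next error term. *)
Lemma hensel_lift (a : 'I_n -> R) :
  (forall i, meval a (P i) = 0) ->
  \matrix_(i, j) meval a (mderiv j (P i)) \in unitmx ->
  forall k, exists z : 'I_n -> {poly R}, (forall i, (z i).[0] = a i) /\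
    forall i, 'X^(k.+1) %| ev z (P i) - 'X * z i ^+ d.
Proof.
move=> Pa0 Junit; elim=> [|k [z [z0 zP]]].
  exists (fun i => (a i)%:P); split=> [i|i]; first by rewrite hornerC.
  rewrite expr1 dvdX_horner0 !hornerE horner_ev subr0.
  by under meval_eq do rewrite hornerC; rewrite Pa0.
have {zP} [r rP] : exists r, forall i,
    ev z (P i) - 'X * z i ^+ d = 'X^(k.+1) * r i.
  exists (fun i => (ev z (P i) - 'X * z i ^+ d) %/ 'X^(k.+1)) => i.
  by rewrite [RHS]mulrC divpK.
set J := \matrix_(i, j) _ in Junit.
pose w : 'cV_n := - (invmx J *m \col_i (r i).[0]).
pose z' i := z i + 'X^(k.+1) * (w i 0)%:P.
exists z'; split=> i; first by rewrite !hornerE z0 expr0n /= mul0r addr0.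
have [c ->] := mmap_taylor polyC z (fun i => (w i 0)%:P) 'X^(k.+1) (P i).
(* A step of order t ^ (k + 1) changes the deformation term t x_i ^ d by a
   multiple of t ^ (k + 2) only. *)
have [b bE] : exists b, z' i ^+ d = z i ^+ d + 'X^(k.+1) * b.
  exists ((w i 0)%:P * \sum_(j < d) z' i ^+ (d.-1 - j) * z i ^+ j).
  apply/eqP; rewrite addrC -subr_eq mulrA subrXX; apply/eqP; congr (_ * _).
  by rewrite /z'; ring.
rewrite bE; set D := \sum_i _.
have -> : ev z (P i) + 'X^(k.+1) * D + 'X^(k.+1) ^+ 2 * c
    - 'X * (z i ^+ d + 'X^(k.+1) * b)
  = 'X^(k.+1) * (r i + D + 'X * ('X^k * c - b)).
  by rewrite -[in RHS]addrA [in RHS]mulrDr -rP !exprS; ring.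
rewrite exprSr dvdp_mul2l ?expf_neq0 ?polyX_eq0 //
  dvdX_horner0 hornerD hornerM hornerX mul0r addr0 hornerD.
have -> : D.[0] = (J *m w) i 0.
  rewrite horner_sum mxE; apply: eq_bigr => j _.
  by rewrite hornerM hornerC horner_ev [J i j]mxE (meval_eq _ z0).
by rewrite /w mulmxN mulKVmx // !mxE subrr.
Qed.

Hypothesis degP : forall i, (msize (P i) <= d)%N.

(** Since t x_i ^ d = P_i on the deformed system and P_i has degree less than d,
    a monomial divisible by some x_i ^ d becomes, after multiplication by t, a
    polynomial of lower degree; induction on the degree then leaves only the
    exponents below d. The exponent s and the coefficients c do not depend on
    the precision k, so that k can be chosen larger than s afterwards. *)
Lemma deformed_reduction (q : {mpoly R[n]}) :
  exists (s : nat) (c : {ffun 'I_n -> 'I_d} -> {poly R}),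
    forall k (z : 'I_n -> {poly R}),
      (forall i, 'X^k %| ev z (P i) - 'X * z i ^+ d) ->
      'X^k %| 'X^s * ev z q - \sum_a c a * \prod_i z i ^+ a i.
Proof.
pose red q := exists (s : nat) (c : {ffun 'I_n -> 'I_d} -> {poly R}),
    forall k (z : 'I_n -> {poly R}),
      (forall i, 'X^k %| ev z (P i) - 'X * z i ^+ d) ->
      'X^k %| 'X^s * ev z q - \sum_a c a * \prod_i z i ^+ a i.
rewrite -/(red q).
have redD p1 p2 : red p1 -> red p2 -> red (p1 + p2).
  move=> [s1 [c1 H1]] [s2 [c2 H2]]; exists (s1 + s2)%N.
  exists (fun a => 'X^s2 * c1 a + 'X^s1 * c2 a) => k z zP.
  have -> : 'X^(s1 + s2) * ev z (p1 + p2)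
      - \sum_a ('X^s2 * c1 a + 'X^s1 * c2 a) * \prod_i z i ^+ a i
    = 'X^s2 * ('X^s1 * ev z p1 - \sum_a c1 a * \prod_i z i ^+ a i)
    + 'X^s1 * ('X^s2 * ev z p2 - \sum_a c2 a * \prod_i z i ^+ a i).
    under eq_bigr do rewrite mulrDl -!mulrA.
    by rewrite big_split /= -!mulr_sumr exprD mmapD; ring.
  by apply: dvdp_add; apply: dvdp_mull; [exact: H1 | exact: H2].
have redZ b p : red p -> red (b *: p).
  move=> [s [c H]]; exists s, (fun a => b%:P * c a) => k z zP.
  under eq_bigr do rewrite -mulrA.
  rewrite -mulr_sumr mmapZ mulrCA -mulrBr.
  by apply: dvdp_mull; exact: H.
have red_supp p : (forall m, m \in msupp p -> red (monom R m)) -> red p.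
  move=> supp_red; rewrite [p]mpolyE big_seq.
  apply: (big_ind red) => // [|m mp]; last exact: redZ (supp_red m mp).
  exists 0, (fun _ => 0) => k z _.
  by rewrite mmap0 mulr0 big1 ?subr0 ?dvdp0 // => a _; rewrite mul0r.
apply: (red_supp) => m _; have [N] := ubnP (mdeg m); elim: N m => // N IH m.
rewrite ltnS => mN.
have [/forallP m_lt|] := boolP [forall i, (m i < d)%N].
  pose a0 := [ffun i => Ordinal (m_lt i)].
  exists 0, (fun a => (a == a0)%:R) => k z _.
  rewrite mul1r mmapX (bigD1 a0) //= eqxx mul1r [X in _ - (_ + X)]big1.
  - rewrite addr0 /mmap1; under [X in _ - X]eq_bigr do rewrite ffunE /=.
    by rewrite subrr dvdp0.
  - by move=> a /negbTE ->; rewrite mul0r.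
rewrite negb_forall => /existsP[i]; rewrite -leqNgt => d_le.
pose e := mnm_muln (mnm1 i) d; pose m' := mnm_sub m e.
have mE : m = mnm_add e m'.
  rewrite addmC submK //; apply/mnm_lepP => j; rewrite mulmnE mnm1E.
  by case: eqP => [<-|_]; rewrite ?mul1n.
have degm : mdeg m = (d + mdeg m')%N.
  by rewrite [in LHS]mE mdegD mdegMn mdeg1 mul1n.
have [|s [c H]] := red_supp (P i * monom R m').
  move=> m1 /msize_mdeg_lt lt_m1; apply: IH; apply: leq_trans lt_m1 _.
  apply: leq_trans mN; rewrite degm.
  have [->|P0] := eqVneq (P i) 0; first by rewrite mul0r msize0.
  rewrite msizeM ?msizeX ?addnS ?leq_add2r ?degP //.
  by rewrite -msize_poly_eq0 msizeX.
exists s.+1, c => k z zP.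
have -> : 'X^(s.+1) * ev z (monom R m) - \sum_a c a * \prod_i z i ^+ a i
  = ('X^s * ev z (P i * monom R m') - \sum_a c a * \prod_i z i ^+ a i)
    - 'X^s * ev z (monom R m') * (ev z (P i) - 'X * z i ^+ d).
  rewrite mE mpolyXD -mpolyXn !rmorphM /= rmorphXn /= [ev z (var i)]mmapX
    mmap1U.
  by rewrite exprS; ring.
by apply: dvdp_sub; [exact: H | apply: dvdp_mull].
Qed.

Lemma separating_poly (a b : 'rV[R]_n) : a != b ->
  exists q : {mpoly R[n]}, meval (a 0) q != 0 /\ meval (b 0) q = 0.
Proof.
rewrite -subr_eq0 => /eqP ab.
have [/forallP all0|] := boolP [forall i, a 0 i == b 0 i].
  by case: ab; apply/rowP => i; rewrite !mxE (eqP (all0 i)) subrr.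
rewrite negb_forall => /existsP[i abi].
exists (var i - mpolyC n (b 0 i)).
by rewrite !mevalB !mevalXU !mevalC subr_eq0 subrr.
Qed.

(** Degenerate zeros of P can be infinitely many, but only nondegenerate ones
    lift to the deformed system, whose monomials all reduce to the d ^ n with
    exponents below d. *)
Lemma bezout_nondegenerate (M : nat) (a : 'I_M -> 'rV[R]_n) :
  injective a ->
  (forall p i, meval (a p 0) (P i) = 0) ->
  (forall p, \matrix_(i, j) meval (a p 0) (mderiv j (P i)) \in unitmx) ->
  (M <= d ^ n)%N.
Proof.
move=> a_inj Pa0 Ja; rewrite leqNgt; apply/negP => dM.
have /fin_all_exists[f fP] (p : 'I_M) : exists f : {mpoly R[n]},
    meval (a p 0) f != 0 /\ forall q, q != p -> meval (a q 0) f = 0.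
  have /fin_all_exists[u uP] (q : 'I_M) : exists u : {mpoly R[n]}, q != p ->
      meval (a p 0) u != 0 /\ meval (a q 0) u = 0.
    have [->|qp] := eqVneq q p; first by exists 0.
    have [|u Hu] := @separating_poly (a p) (a q); last by exists u.
    by rewrite (inj_eq a_inj) eq_sym.
  exists (\prod_(q | q != p) u q); split=> [|q qp]; rewrite rmorph_prod /=.
    by apply/prodf_neq0 => q qp; case: (uP q qp).
  by rewrite (bigD1 q) //= (uP q qp).2 mul0r.
have [s0 /fin_all_exists[c0 red]] :=
  fin_all_exists (fun p => deformed_reduction (f p)).
pose s := \max_p s0 p.
have s0s p : (s0 p <= s)%N by exact: leq_bigmax.
have /fin_all_exists[z zP] (p : 'I_M) : exists z : 'I_n -> {poly R},
    (forall i, (z i).[0] = a p 0 i) /\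
    forall i, 'X^(s.+1) %| ev z (P i) - 'X * z i ^+ d.
  exact: hensel_lift.
pose A := \matrix_(p < M, b < #|{ffun 'I_n -> 'I_d}|)
  ('X^(s - s0 p) * c0 p (enum_val b)).
pose B := \matrix_(b < #|{ffun 'I_n -> 'I_d}|, q < M)
  (\prod_i z q i ^+ (enum_val b : {ffun 'I_n -> 'I_d}) i).
(* A product through dimension d ^ n < M is singular over the field R(t). *)
have det0 : \det (A *m B) = 0.
  apply/eqP; rewrite -tofrac_eq0 -det_map_mx map_mxM /=.
  apply: contraLR dM => detN0.
  have : map_mx (@tofrac {poly R}) A *m map_mx (@tofrac _) B \in unitmx.
    by rewrite unitmxE unitfE.
  rewrite -row_free_unit /row_free => /eqP rkM; rewrite -leqNgt -{1}rkM.
  apply: leq_trans (mxrankM_maxl _ _) _; apply: leq_trans (rank_leq_col _) _.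
  by rewrite card_ffun !card_ord.
have /fin_all_exists[r rE] (pq : 'I_M * 'I_M) : exists r : {poly R},
    (A *m B) pq.1 pq.2 = 'X^s * (ev (z pq.2) (f pq.1) - 'X * r).
  case: pq => p q /=.
  have : 'X^(s.+1) %| 'X^s * ev (z q) (f p) - (A *m B) p q.
    have -> : 'X^s * ev (z q) (f p) - (A *m B) p q = 'X^(s - s0 p) *
       ('X^(s0 p) * ev (z q) (f p) - \sum_b c0 p b * \prod_i z q i ^+ b i).
      rewrite mulrBr mulrA -exprD subnK // mxE; congr (_ - _).
      rewrite mulr_sumr [RHS](reindex_onto enum_val enum_rank) /=; last first.
        by move=> b _; rewrite enum_rankK.
      under [RHS]eq_bigl do rewrite enum_valK eqxx.
      by apply: eq_bigr => b _; rewrite !mxE mulrA.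
    by apply: dvdp_mull; apply: red; case: (zP q).
  move/dvdpP => [r rE]; exists r; apply/eqP; rewrite mulrBr mulrCA mulrA -exprS.
  by rewrite [_ * r]mulrC -rE subKr.
(* Cancelling t ^ s leaves a matrix with zero determinant, whose value at
   t = 0 is diagonal with nonzero entries. *)
pose G := \matrix_(p, q) (ev (z q) (f p) - 'X * r (p, q)).
have ABE : A *m B = 'X^s *: G.
  by apply/matrixP => p q; rewrite [LHS](rE (p, q)) [RHS]mxE [in RHS]mxE.
move: det0; rewrite ABE detZ => /eqP; rewrite mulf_eq0 !expf_eq0 polyX_eq0.
rewrite !andbF /= => /eqP /(congr1 (fun u => u.[0])).
rewrite horner0 -[LHS]/(horner_eval 0 _) -det_map_mx.
have -> : map_mx (horner_eval 0) G = diag_mx (\row_p meval (a p 0) (f p)).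
  apply/matrixP => p q; rewrite !mxE /horner_eval hornerD hornerN hornerM
    hornerX mul0r subr0 horner_ev.
  rewrite (meval_eq (v2 := a q 0)); last by case: (zP q).
  by case: eqVneq => [->|pq]; rewrite ?mulr1n // mulr0n (fP p).2 // eq_sym.
rewrite det_diag => /eqP; apply/negP; apply/prodf_neq0 => p _.
by rewrite mxE; case: (fP p).
Qed.
End Finiteness.

Lemma finite_nondegenerate_zeros (R : fieldType) n (P : 'I_n -> {mpoly R[n]}) :
  (forall a : 'rV[R]_n, (forall i, meval (a 0) (P i) = 0) ->
     \matrix_(i, j) meval (a 0) (mderiv j (P i)) \in unitmx) ->
  finite_set [set a : 'rV[R]_n | forall i, meval (a 0) (P i) = 0].
Proof.
move=> nondeg; apply: contrapT => infZ.
pose d := (\max_i msize (P i)).+1.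
have [B BZ] := infinite_set_fset (d ^ n).+1 infZ; apply/negP; rewrite -leqNgt.
pose a (p : 'I_(size (finmap.enum_fset B))) := nth 0 (finmap.enum_fset B) p.
have Za p i : meval (a p 0) (P i) = 0 by apply: BZ; exact: mem_nth.
apply: (@bezout_nondegenerate _ _ d P _ _ a) => // [i|p q /eqP|p].
- by apply: leqW; exact: leq_bigmax.
- by rewrite nth_uniq // ?finmap.fset_uniq // => /eqP/val_inj.
- by apply: nondeg; exact: Za.
Qed.

(** * Affine polynomials *)

(** An affine polynomial is given by its values, whereas derivatives are formal.
    The two are compared on the line x + t e_i, where the Taylor expansion is an
    identity between polynomial functions of t. *)
Lemma mderiv_affine (R : realType) n (q : {mpoly R[n]}) (a : 'rV_n) b :
  (forall x, polyfun q x = dot a x + b) ->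
  forall i x, polyfun (mderiv i q) x = a 0 i.
Proof.
move=> qE i x.
have [c cE] := mmap_taylor (@polyC R) (fun j => (x 0 j)%:P)
  (fun j => (j == i)%:R) 'X q.
have ev_line t : polyfun q x + t * (polyfun (mderiv i q) x) + t ^+ 2 * c.[t]
    = polyfun q x + t * a 0 i.
  have := congr1 (fun u => u.[t]) cE.
  rewrite /= !(hornerD, hornerM, hornerX, hornerXn) !horner_ev.
  rewrite (bigD1 i) //= eqxx mulr1 big1 ?addr0 => [|j /negbTE ->];
    last by rewrite mulr0.
  rewrite !horner_ev !(meval_eq (v1 := fun j => (_)%:P.[_]) (v2 := x 0)) =>
    [|j|j]; try by rewrite hornerC.
  rewrite -/(polyfun _ _) => <-.
  rewrite (meval_eq (v2 := (x + t *: \row_j (j == i)%:R) 0)) => [|j].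
    rewrite -/(polyfun _ _) !qE [dot a (_ + _)](_ : _ = dot a x + t * a 0 i).
      by ring.
    rewrite /dot; under eq_bigr do rewrite !mxE mulrDr.
    rewrite big_split /=; congr (_ + _).
    rewrite (bigD1 i) //= eqxx mulr1 big1 ?addr0 1?mulrC // => j /negbTE ->.
    by rewrite !mulr0.
  by rewrite !(hornerE, mxE); case: (j == i); rewrite ?hornerE.
set D := polyfun (mderiv i q) x in ev_line *.
(* Dividing by t leaves an identity that is known at the points t = 1, 2, ...
   only; this still forces it at t = 0. *)
suff : (D - a 0 i)%:P + 'X * c = 0.
  move/(congr1 (fun u => u.[0])); rewrite /= hornerD hornerM hornerX hornerC
    mul0r addr0 hornerC.
  by move/eqP; rewrite subr_eq0 => /eqP.
set r := _ + _.
apply: (@roots_geq_poly_eq0 _ _ [seq k.+1%:R | k <- iota 0 (size r)]).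
- apply/allP => _ /mapP[k _ ->]; apply/rootP.
  rewrite !(hornerD, hornerM, hornerX, hornerC).
  have k0 : k.+1%:R != 0 :> R by rewrite pnatr_eq0.
  apply: (mulfI k0); rewrite mulr0; have := ev_line k.+1%:R.
  by rewrite -addrA => /addrI /eqP; rewrite -subr_eq0 => /eqP <-; ring.
- by rewrite map_inj_uniq ?iota_uniq // =>
    k1 k2 /(@mulrIn _ 1 (oner_neq0 R)) [].
- by rewrite size_map size_iota.
Qed.

(** * Adding variables *)

Section Embedding.
Variables (R : comNzRingType) (n k : nat).

Definition embed (q : {mpoly R[n]}) : {mpoly R[n + k]} :=
  mmap (@mpolyC (n + k) R) (fun i => var (lshift k i)) q.

Lemma meval_embed (a : 'rV[R]_(n + k)) q :
  meval (a 0) (embed q) = meval (lsubmx a 0) q.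
Proof.
rewrite /embed; elim/mpoly_ring_ind: q => [c|i|p q Ep Eq|p q Ep Eq].
- by rewrite mmapC !mevalC.
- by rewrite mmapX mmap1U !mevalXU mxE.
- by rewrite mmapD !mevalD Ep Eq.
- by rewrite rmorphM /= !mevalM Ep Eq.
Qed.

Lemma mderiv_embed_l i q : mderiv (lshift k i) (embed q) = embed (mderiv i q).
Proof.
rewrite /embed; elim/mpoly_ring_ind: q => [c|j|p q Ep Eq|p q Ep Eq].
- by rewrite mmapC !mderivC mmap0.
- rewrite mmapX mmap1U !mderiv_var (inj_eq (@lshift_inj _ _)).
  by case: (j == i); rewrite ?rmorph1 ?rmorph0.
- by rewrite mmapD !mderivD Ep Eq mmapD.
- by rewrite rmorphM /= !mderivM Ep Eq mmapD !rmorphM.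
Qed.

Lemma mderiv_embed_r i q : mderiv (rshift n i) (embed q) = 0.
Proof.
rewrite /embed; elim/mpoly_ring_ind: q => [c|j|p q Ep Eq|p q Ep Eq].
- by rewrite mmapC !mderivC.
- by rewrite mmapX mmap1U !mderiv_var eq_lrshift.
- by rewrite mmapD !mderivD Ep Eq addr0.
- by rewrite rmorphM /= !mderivM Ep Eq mul0r mulr0 addr0.
Qed.
End Embedding.

(** * The system Phi_alpha *)

Section KKT.
Variables (R : realType) (n m l : nat) (F : 'I_n -> {mpoly R[n]}).
Variables (g : 'I_m -> {mpoly R[n]}) (h : 'I_l -> {mpoly R[n]}).

Section Phi.
Variable alpha : {set 'I_m}.
Local Notation N := (n + (#|alpha| + l))%N.

(** Phi_alpha as a system of polynomials in (x, lambda, mu), the rows and the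
    variables being grouped as in [DPhi]. *)
Definition kkt_map (i : 'I_N) : {mpoly R[N]} :=
  match fintype.split i with
  | inl i => embed _ (F i)
      + \sum_k var (rshift n (lshift l k)) * embed _ (mderiv i (g (enum_val k)))
      + \sum_j var (rshift n (rshift #|alpha| j)) * embed _ (mderiv i (h j))
  | inr k => match fintype.split k with
    | inl k => embed _ (g (enum_val k))
    | inr j => embed _ (h j)
    end
  end.

Lemma kkt_map_top i : kkt_map (lshift _ i) = embed _ (F i)
      + \sum_k var (rshift n (lshift l k)) * embed _ (mderiv i (g (enum_val k)))
      + \sum_j var (rshift n (rshift #|alpha| j)) * embed _ (mderiv i (h j)).
Proof. by rewrite /kkt_map (unsplitK (inl _)). Qed.

Lemma kkt_map_ineq k : kkt_map (rshift n (lshift l k)) =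
  embed _ (g (enum_val k)).
Proof. by rewrite /kkt_map (unsplitK (inr _)) (unsplitK (inl _)). Qed.

Lemma kkt_map_eq j : kkt_map (rshift n (rshift #|alpha| j)) = embed _ (h j).
Proof. by rewrite /kkt_map (unsplitK (inr _)) (unsplitK (inr _)). Qed.

Hypothesis h_affine : forall j, affine_poly (h j).

(** This is why the Jacobian of [kkt_map] does not involve mu. The first
    derivatives of an affine polynomial are constant, hence affine
    themselves. *)
Lemma affine_hessian0 i i' j x : polyfun (mderiv i (mderiv i' (h j))) x = 0.
Proof.
have [a [b hE]] := h_affine j.
rewrite (@mderiv_affine _ _ _ 0 (a 0 i')) ?mxE // => y.
by rewrite (mderiv_affine hE) /dot big1 ?add0r // => k _; rewrite mxE mul0r.
Qed.

Lemma jacobian_kkt_map (a : 'rV[R]_N) :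
  \matrix_(i, j) meval (a 0) (mderiv j (kkt_map i)) =
  DPhi F g h (lsubmx a) (lsubmx (rsubmx a)).
Proof.
apply/matrixP => i j; rewrite mxE /DPhi.
rewrite -(fintype.splitK i) -(fintype.splitK j);
  case: (fintype.split i) => {}i; case: (fintype.split j) => {}j /=.
- rewrite block_mxEul kkt_map_top 2!mderivD 2!mevalD.
  rewrite [X in _ + meval _ X + _]raddf_sum [X in _ + meval _ X]raddf_sum /=.
  rewrite [in RHS]mxE mderiv_embed_l meval_embed -addrA; congr (_ + _).
    by rewrite mxE.
  rewrite 2!raddf_sum /=.
  rewrite [X in _ + X]big1 ?addr0 => [|k _].
    rewrite summxE; apply: eq_bigr => k _.
    rewrite mderivM mderiv_var eq_rlshift mul0r add0r mderiv_embed_l mevalM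
      mevalXU.
    by rewrite meval_embed mderiv_comm !mxE.
  rewrite mderivM mderiv_var eq_rlshift mul0r add0r mderiv_embed_l mevalM.
  by rewrite meval_embed [X in _ * X]affine_hessian0 mulr0.
- rewrite block_mxEur kkt_map_top 2!mderivD mderiv_embed_r add0r mevalD.
  rewrite [X in meval _ X + _]raddf_sum [X in _ + meval _ X]raddf_sum
    2!raddf_sum /=.
  rewrite -(fintype.splitK j); case: (fintype.split j) => {}j /=.
  + rewrite row_mxEl !mxE (bigD1 j) //= !big1 ?addr0 => [|k _|k kj].
    * by rewrite mderivM mderiv_var eqxx mul1r mderiv_embed_r mulr0 addr0
        meval_embed.
    * by rewrite mderivM mderiv_var mderiv_embed_r (inj_eq (@rshift_inj _ _))
        eq_rlshift mul0r mulr0 addr0 meval0.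
    * rewrite mderivM mderiv_var mderiv_embed_r (inj_eq (@rshift_inj _ _))
        (inj_eq (@lshift_inj _ _)).
      by rewrite (negbTE kj) mul0r mulr0 addr0 meval0.
  + rewrite row_mxEr !mxE [X in _ + X](bigD1 j) //= !big1 ?addr0 ?add0r =>
      [|k kj|k _].
    * by rewrite mderivM mderiv_var eqxx mul1r mderiv_embed_r mulr0 addr0
        meval_embed.
    * rewrite mderivM mderiv_var mderiv_embed_r !(inj_eq (@rshift_inj _ _)).
      by rewrite (negbTE kj) mul0r mulr0 addr0 meval0.
    * by rewrite mderivM mderiv_var mderiv_embed_r (inj_eq (@rshift_inj _ _))
        eq_lrshift mul0r mulr0 addr0 meval0.
- rewrite block_mxEdl -(fintype.splitK i); case: (fintype.split i) => {}i /=.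
  + by rewrite col_mxEu kkt_map_ineq mderiv_embed_l meval_embed !mxE.
  + by rewrite col_mxEd kkt_map_eq mderiv_embed_l meval_embed !mxE.
- rewrite block_mxEdr mxE -(fintype.splitK i);
    case: (fintype.split i) => {}i /=.
  + by rewrite kkt_map_ineq mderiv_embed_r meval0.
  + by rewrite kkt_map_eq mderiv_embed_r meval0.
Qed.

End Phi.

(** * From solutions to zeros of Phi_alpha *)

Lemma tangent_dot_ge0 (K : set 'rV[R]_n) (G : 'rV[R]_n -> 'rV[R]_n) x v :
  Sol K G x -> tangent_cone K x v -> 0 <= dot (G x) v.
Proof.
move=> [_ xS] [y [t [[yK t0] _ _ yv]]].
have dot_cvg : dot (G x) ((t k)^-1 *: (y k - x)) @[k --> \oo] --> dot (G x) v.
  apply: cvg_big => [|i _]; first exact: add_continuous.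
  apply: cvgM; first exact: cvg_cst.
  exact: (cvg_comp _ _ yv (@coord_continuous _ _ _ 0 i v)).
rewrite -(cvg_lim (@Rhausdorff R) dot_cvg).
apply: limr_ge; first exact: cvgP dot_cvg.
apply: nearW => k /=.
have -> : dot (G x) ((t k)^-1 *: (y k - x)) = (t k)^-1 * dot (G x) (y k - x).
  by rewrite /dot mulr_sumr; apply: eq_bigr => i _; rewrite mxE mulrCA.
by rewrite mulr_ge0 ?xS // invr_ge0 ltW.
Qed.

Definition active x : {set 'I_m} := [set i | polyfun (g i) x == 0]%SET.

(** The row space of a matrix B is the annihilator of its kernel, so it suffices
    that F x vanishes on every v with B v = 0. The rows of B are the active
    gradients, so for such v both v and - v are tangent to the feasible set. *)
Lemma Sol_kkt x : Sol (feasible_set g h) (polymap F) x -> abadie_cq g h x ->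
  exists lm : 'rV[R]_(#|active x| + l),
    forall i, meval ((row_mx x lm) 0) (kkt_map (alpha := active x) i) = 0.
Proof.
move=> xS acq.
pose B := col_mx (grad_ineq g (active x) x)^T (grad_eq h x)^T.
have FB : (polymap F x <= B)%MS.
  rewrite submxE; apply/eqP/rowP => j; rewrite [RHS]mxE.
  (* The columns of [cokermx B] span the column kernel of B. *)
  pose v := (col j (cokermx B))^T.
  have : B *m v^T = 0 by rewrite trmxK colE mulmxA mulmx_coker mul0mx.
  rewrite mul_col_mx -col_mx0 => /eq_col_mx[gv hv].
  have lin s : linearized_cone g h x (s *: v).
    have dotZ u : dot u (s *: v) = s * dot u v.
      by rewrite /dot mulr_sumr; apply: eq_bigr => i _; rewrite mxE mulrCA.
    split=> [i gi0|i]; rewrite dotZ.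
      have iA : i \in active x by rewrite inE gi0.
      have := congr1 (fun M : 'cV_#|active x| => M (enum_rank_in iA i) 0) gv;
        rewrite !mxE => gv0.
      rewrite le_eqVlt (_ : dot _ _ = 0) ?mulr0 ?eqxx // -[RHS]gv0.
      by apply: eq_bigr => k _; rewrite !mxE enum_rankK_in.
    have := congr1 (fun M : 'cV_l => M i 0) hv; rewrite !mxE => hv0.
    rewrite (_ : dot _ _ = 0) ?mulr0 // -[RHS]hv0.
    by apply: eq_bigr => k _; rewrite !mxE.
  have ge0 s : 0 <= dot (polymap F x) (s *: v).
    by apply: (tangent_dot_ge0 xS); rewrite -acq.
  rewrite mxE; apply/eqP; rewrite eq_le; apply/andP; split.
    rewrite -oppr_ge0; apply: le_trans (ge0 (-1)) _; rewrite le_eqVlt;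
      apply/orP; left.
    by apply/eqP; rewrite -sumrN; apply: eq_bigr => k _;
      rewrite !mxE mulN1r mulrN.
  apply: le_trans (ge0 1) _; rewrite le_eqVlt; apply/orP; left.
  by apply/eqP; apply: eq_bigr => k _; rewrite !mxE mul1r.
have [w FE] := submxP FB.
exists (- w) => i; rewrite -(fintype.splitK i);
  case: (fintype.split i) => {}i /=; last first.
  rewrite -(fintype.splitK i); case: (fintype.split i) => {}i /=.
    rewrite kkt_map_ineq meval_embed row_mxKl; apply/eqP.
    by have := enum_valP i; rewrite inE.
  by rewrite kkt_map_eq meval_embed row_mxKl; case: xS => -[_ hx] _; exact: hx.
rewrite kkt_map_top !mevalD meval_embed row_mxKl.
rewrite [X in _ + X + _]raddf_sum [X in _ + X]raddf_sum /=.
have := congr1 (fun M : 'rV_n => M 0 i) FE; rewrite [LHS]mxE /polyfun => ->.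
rewrite -{1}[w]hsubmxK mul_row_col !mxE -addrA; apply/eqP.
rewrite addrACA; apply/eqP; rewrite -!big_split /= !big1 ?addr0 // => k _.
  by rewrite mevalM mevalXU meval_embed row_mxKl row_mxEr !mxE mulNr subrr.
by rewrite mevalM mevalXU meval_embed row_mxKl row_mxEr !mxE mulNr subrr.
Qed.

End KKT.

Theorem theorem4p1 (R : realType) (n m l : nat)
    (F : 'I_n -> {mpoly R[n]})
    (g : 'I_m -> {mpoly R[n]}) (h : 'I_l -> {mpoly R[n]}) :
  (forall i, convex_poly (g i)) ->
  (forall j, affine_poly (h j)) ->
  feasible_set g h !=set0 ->
  (forall x, feasible_set g h x -> abadie_cq g h x) ->
  (forall (alpha : {set 'I_m}) (x : 'rV[R]_n) (lambda : 'rV[R]_#|alpha|),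
     \rank (DPhi F g h x lambda) = (n + #|alpha| + l)%N) ->
  finite_set (Sol (feasible_set g h) (polymap F)).
Proof.
move=> _ h_affine _ acq full_rank.
pose Z (alpha : {set 'I_m}) :=
  [set a : 'rV[R]_(n + (#|alpha| + l)) |
    forall i, meval (a 0) (kkt_map F g h (alpha := alpha) i) = 0].
apply: (@sub_finite_set _ _
  (\bigcup_(alpha in setT) (@lsubmx _ _ _ _ @` Z alpha))).
  move=> x xS; exists (active g x) => //.
  have [lm lmP] := Sol_kkt xS (acq _ xS.1).
  by exists (row_mx x lm); rewrite ?row_mxKl.
apply: bigcup_finite => [|alpha _]; first exact: finite_finset.
apply: finite_image; apply: finite_nondegenerate_zeros => a _.
by rewrite jacobian_kkt_map // -row_free_unit /row_free full_rank addnA.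
Qed.
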